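(* There exists $n_0\in\mathbb{N}$ such that for all integers $n\geq n_0$, \[\left\lceil\frac{n^2}{4}+\frac{5n}{2}\right\rceil+1\;\leq\; f_3(n)\;\leq\; \left\lceil\frac{n^2}{4}+\frac{5n}{2}\right\rceil+12.\]
   Context: Let $d(x,y)$ denote Euclidean distance in $\mathbb{R}^3$. For a finite set $S\subset\mathbb{R}^3$ and a function $r\colon S\to(0,\infty)$, let $\vec{E}_r(S)=\{(x,y) : x,y\in S,\ d(x,y)=r(x)\}$ (a set of ordered pairs) and $e_r(S)=|\vec{E}_r(S)|$. Define \[ f_3(n)=\max\{e_r(S) : S\subset\mathbb{R}^3,\ |S|=n,\ r\colon S\to(0,\infty)\}.\] *)

(* Defs.v *)
From HB Require Import structures.
From mathcomp Require Import all_boot all_order all_algebra.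
From mathcomp Require Import finmap.
From mathcomp Require Import boolp classical_sets reals.

Set Implicit Arguments.
Unset Strict Implicit.
Unset Printing Implicit Defensive.

Import Order.TTheory GRing.Theory Num.Theory.

Local Open Scope fset_scope.
Local Open Scope classical_set_scope.
Local Open Scope ring_scope.

(* The norm that MathComp-Analysis puts on 'rV[R]_3 is the sup norm, so the
   Euclidean distance is defined by hand. *)
Definition edist (R : realType) (x y : 'rV[R]_3) : R :=
  Num.sqrt (\sum_(i < 3) (x ord0 i - y ord0 i) ^+ 2).

(* The radius function is total on R^3; only its values on S matter. *)
Definition fav_edges (R : realType) (S : {fset 'rV[R]_3}) (r : 'rV[R]_3 -> R) :
    {fset 'rV[R]_3 * 'rV[R]_3} :=
  [fset p in S `*` S | edist p.1 p.2 == r p.1]%fset.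

Definition num_fav_edges (R : realType) (S : {fset 'rV[R]_3})
    (r : 'rV[R]_3 -> R) : nat :=
  #|` fav_edges S r|.

Definition fav_counts (R : realType) (n : nat) : set nat :=
  [set m | exists (S : {fset 'rV[R]_3}) (r : 'rV[R]_3 -> R),
    [/\ #|` S| = n, {in S, forall x, 0 < r x} & num_fav_edges S r = m]].

(* The default value 0 of xget is never used: see f3P. *)
Definition f3 (R : realType) (n : nat) : nat :=
  xget 0%N [set m | fav_counts R n m /\ ubound (fav_counts R n) m].

Lemma f3P (R : realType) (n : nat) :
  fav_counts R n (f3 R n) /\ ubound (fav_counts R n) (f3 R n).
Proof.
apply: (@xgetPex _ 0%N [set m | fav_counts R n m /\ ubound (fav_counts R n) m]).
have ex : exists m, `[< fav_counts R n m >].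
  pose pt (i : nat) : 'rV[R]_3 := const_mx i%:R.
  have pt_inj : injective pt.
    move=> i j /matrixP/(_ ord0 ord0); rewrite !mxE => /eqP.
    by rewrite eqr_nat => /eqP.
  pose S : {fset 'rV[R]_3} := [fset pt i | i in iota 0 n]%fset.
  exists (num_fav_edges S (fun=> 1)); apply/asboolP; exists S, (fun=> 1).
  split=> //; rewrite card_imfset //= undup_id ?size_iota//; exact: iota_uniq.
have ub m : `[< fav_counts R n m >] -> (m <= n * n)%N.
  move=> /asboolP[S [r [<- _ <-]]].
  rewrite -(size_allpairs pair S S); apply: uniq_leq_size => [|[x y]].
    exact: fset_uniq.
  by rewrite !inE /= => /andP[/andP[xS yS] _]; apply: allpairs_f.
case: (ex_maxnP ex ub) => m /asboolP mP mmax; exists m; split=> // k kP.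
by rewrite leEnat; apply: mmax; apply/asboolP.
Qed.

(* Main.v *)
(* Call (L, C) a Lenz pair if C lies on a circle and L consists of points x on
   the axis of that circle with r(x) equal to the distance from x to the circle.

   Upper bound. Write x -> y when d(x, y) = r(x). Deleting a point whose in- and
   out-degree add up to less than n/2 only makes the claimed bound harder to
   satisfy, so one may assume that there is none. Then there are at least n^2/4
   edges, so by pigeonhole some A -> B is complete with A and B large; the points
   equidistant from three points of a sphere form a line, hence A and B sit in a
   Lenz pair (L, C). A sphere meets a line or a circle that it does not contain in
   at most two points, and two spheres centred on the axis determine the circle, so
   counting the edges at A and at B shows that L and C both have about n/2 points.
   An outside point has bounded degree except for edges coming from C, so it gets
   edges from almost all of C. Three outside points would then have three common
   in-neighbours on C, which would be collinear. With at most two outside points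
   the edges can be counted exactly.

   Lower bound. With a points on the circle and b on the axis, each circle point can
   have out-degree 4 and the axis points can have b - 1 edges among themselves, which
   gives ab + 4a + b - 1 edges. Take squares on the circle (radius sqrt 2, axis
   neighbours 1 and -1). Up to three more points of a square are adjusted through a
   rotation u of angle arccos(1/3), whose chord 2/sqrt 3 is the distance from
   1/sqrt 3 and -1/sqrt 3 on the axis to the circle: if the squares at 1 and u^2 are
   present, every point of the square at u has two neighbours at that distance. *)
Require Import Defs.
From mathcomp Require Import all_boot all_order all_algebra.
From mathcomp Require Import finmap reals.
From mathcomp Require Import zify ring lra.
Import Order.TTheory GRing.Theory Num.Theory.

Set Implicit Arguments.
Unset Strict Implicit.
Unset Printing Implicit Defensive.

(** * Digraphs covered by Lenz pairs *)

Definition out (T : finType) (e : rel T) (x : T) := [set y | e x y].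
Definition inn (T : finType) (e : rel T) (y : T) := [set x | e x y].
Definition nedges (T : finType) (e : rel T) := \sum_x #|out e x|.

(* The combinatorial content of: [C] lies on a circle and [L] consists of the
   centres of spheres through it. In [lenz_K33] the spheres centred at [P] are in
   play: their centres are not collinear. *)
Record lenz_pair (T : finType) (e : rel T) (L C : {set T}) : Prop := LenzPair {
  lenz_disj : [disjoint L & C];
  lenz_outC : forall v, v \notin L -> #|out e v :&: C| <= 2;
  lenz_outL : forall v, #|out e v :&: L| <= 2;
  lenz_inL : forall v, v \notin C -> #|inn e v :&: L| <= 1;
  lenz_K33 : forall P : {set T}, P \subset C -> #|P| = 3 ->
    #|[set q | P \subset inn e q]| <= 2 }.

Definition lenz_rel (T : finType) (e : rel T) : Prop :=
  forall A B : {set T}, 2 < #|A| -> 2 < #|B| ->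
    (forall x y, x \in A -> y \in B -> e x y) ->
  exists L C : {set T}, [/\ A \subset L, B \subset C & lenz_pair e L C].

(** * Double counting of edges *)

Lemma card_set_sum (T : finType) (A B : {set T}) :
  #|A :&: B| = \sum_(x in B) (x \in A).
Proof.
rewrite -sum1_card big_mkcond /= [RHS]big_mkcond /=.
by apply: eq_bigr => x _; rewrite inE; case: (x \in A); case: (x \in B).
Qed.

Lemma double_count (T : finType) (e : rel T) (A B : {set T}) :
  \sum_(x in A) #|out e x :&: B| = \sum_(y in B) #|inn e y :&: A|.
Proof.
under eq_bigr do rewrite card_set_sum.
rewrite exchange_big /=; apply: eq_bigr => y _; rewrite card_set_sum.
by apply: eq_bigr => x _; rewrite !inE.
Qed.

Lemma double_countT (T : finType) (e : rel T) (A : {set T}) :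
  \sum_(x in A) #|out e x| = \sum_y #|inn e y :&: A|.
Proof.
under eq_bigr do rewrite -[out e _]setIT.
by rewrite double_count; apply: eq_bigl => y; rewrite inE.
Qed.

Lemma double_countTr (T : finType) (e : rel T) (B : {set T}) :
  \sum_(y in B) #|inn e y| = \sum_x #|out e x :&: B|.
Proof.
under eq_bigr do rewrite -[inn e _]setIT.
by rewrite -double_count; apply: eq_bigl => y; rewrite inE.
Qed.

Lemma nedges_inn (T : finType) (e : rel T) : nedges e = \sum_y #|inn e y|.
Proof.
have := double_countT e [set: T]; under eq_bigl do rewrite inE.
by rewrite -/(nedges e) => ->; apply: eq_bigr => y _; rewrite setIT.
Qed.

Lemma sum_le_const (T : finType) (P : pred T) (F : T -> nat) c :
  (forall x, P x -> F x <= c) -> \sum_(x | P x) F x <= #|P| * c.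
Proof. by move=> Fc; rewrite -sum_nat_const; apply: leq_sum. Qed.

Lemma card_subset_exact (T : finType) (A : {set T}) k :
  k <= #|A| -> exists2 B : {set T}, B \subset A & #|B| = k.
Proof.
move=> kA; have : 0 < #|[set B : {set T} | B \subset A & #|B| == k]|.
  by rewrite cards_draws bin_gt0.
by move=> /card_gt0P[B]; rewrite inE => /andP[BA /eqP Bk]; exists B.
Qed.

(** Each triple in [B] has at most two common out-neighbours by [lenz_K33]; the sum counts these
    incidences from the other end. *)
Lemma sum_bin3 (T : finType) (e : rel T) (L C B : {set T}) :
  lenz_pair e L C -> B \subset C ->
  \sum_v 'C(#|inn e v :&: B|, 3) <= 2 * 'C(#|B|, 3).
Proof.
move=> LC BC.
have -> : \sum_v 'C(#|inn e v :&: B|, 3) =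
    \sum_(P : {set T} | (P \subset B) && (#|P| == 3))
       #|[set q | P \subset inn e q]|.
  under [RHS]eq_bigr do rewrite -sum1_card big_mkcond.
  rewrite exchange_big /=; apply: eq_bigr => v _.
  rewrite -cards_draws -sum1_card big_mkcond [RHS]big_mkcond /=.
  apply: eq_bigr => P _; rewrite !inE subsetI.
  by case: (P \subset inn e v); case: (P \subset B); case: (#|P| == 3).
rewrite mulnC -cards_draws; set X := [set P : {set T} | _].
have -> : \sum_(P : {set T} | (P \subset B) && (#|P| == 3))
       #|[set q | P \subset inn e q]| =
   \sum_(P in X) #|[set q | P \subset inn e q]|.
  by apply: eq_bigl => P; rewrite inE.
apply: sum_le_const => P /=; rewrite inE => /andP[PB /eqP P3].
by apply: (lenz_K33 LC) => //; apply: subset_trans BC.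
Qed.

(** What a degree has beyond 2 is charged to triples, so that [sum_bin3] bounds a sum of degrees. *)
Lemma leq_bin3 d : d <= 2 + 'C(d, 3).
Proof.
case: d => [|[|[|d]]] //; elim: d => // d IH.
rewrite binS; have : 0 < 'C(d.+3, 2) by rewrite bin_gt0.
lia.
Qed.

(** * Degrees and edges around a Lenz pair *)

Lemma out_card_split (T : finType) (A L C : {set T}) :
  [disjoint L & C] ->
  #|A| = #|A :&: L| + #|A :&: C| + #|A :&: ~: (L :|: C)|.
Proof.
move=> dLC; rewrite -(cardsID (L :|: C) A) setIUr cardsU setDE.
have -> : (A :&: L) :&: (A :&: C) = set0.
  apply/setP => x; rewrite !inE; have := disjointFr dLC (x := x).
  by case: (x \in L) => [->|] //; rewrite ?andbF //= !andbF.
by rewrite cards0 subn0.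
Qed.

(** Summing the degree condition over [A] gives [C] at least half of the vertices, and over [B] the
    same for [L], up to a fraction of order [1 / s] and a constant. *)
Lemma lenz_big (T : finType) (e : rel T) (L C A B : {set T}) s :
  lenz_pair e L C -> A \subset L -> B \subset C -> #|A| = s -> #|B| = s ->
  (forall x, #|T| <= 2 * (#|out e x| + #|inn e x|)) ->
  s * #|T| <= 2 * (#|C| * s) + 6 * #|T| /\
  s * #|T| <= 2 * (#|L| * s) + 8 * #|T| + 4 * 'C(s, 3).
Proof.
move=> LC AL BC As Bs deg.
have main (X : {set T}) : #|X| * #|T| <=
    2 * (\sum_v #|inn e v :&: X| + \sum_v #|out e v :&: X|).
  rewrite -double_countT -double_countTr -big_split /= -sum_nat_const big_distrr /=.
  by apply: leq_sum => x _.
have sumT (c : nat) (F : T -> nat) : (forall v, F v <= c) -> \sum_v F v <= c * #|T|.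
  by move=> Fc; rewrite mulnC; apply: sum_le_const.
split.
- have := main A; rewrite As.
  have h1 : \sum_v #|out e v :&: A| <= 2 * #|T|.
    apply: sumT => v; apply: leq_trans (lenz_outL LC v).
    by apply: subset_leq_card; apply: setIS.
  have h2 : \sum_v #|inn e v :&: A| <= #|C| * s + #|T|.
    rewrite (bigID (mem C)) /=; apply: leq_add.
      apply: sum_le_const => v _; rewrite -As; apply: subset_leq_card; exact: subsetIr.
    apply: (@leq_trans (#|[predC C]| * 1)); last by rewrite muln1 max_card.
    apply: sum_le_const => v vC; apply: leq_trans (lenz_inL LC vC).
    by apply: subset_leq_card; apply: setIS.
  lia.
- have := main B; rewrite Bs.
  have h1 : \sum_v #|out e v :&: B| <= #|L| * s + 2 * #|T|.
    rewrite (bigID (mem L)) /=; apply: leq_add.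
      apply: sum_le_const => v _; rewrite -Bs; apply: subset_leq_card; exact: subsetIr.
    apply: (@leq_trans (#|[predC L]| * 2)).
      apply: sum_le_const => v vL; apply: leq_trans (lenz_outC LC vL).
      by apply: subset_leq_card; apply: setIS.
    by rewrite mulnC leq_mul2l max_card.
  have h2 : \sum_v #|inn e v :&: B| <= 2 * #|T| + 2 * 'C(s, 3).
    rewrite -Bs; apply: (@leq_trans (\sum_v (2 + 'C(#|inn e v :&: B|, 3)))).
      by apply: leq_sum => v _; apply: leq_bin3.
    rewrite big_split /=; apply: leq_add; first exact: sumT.
    exact: (sum_bin3 LC BC).
  lia.
Qed.

(** Apart from edges from [C], an outside vertex has only two to [L], two to [C], one from [L] and
    those among outside vertices. When these are few, [W] needs about [3 / 2 * #|T|] edges from [C],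
    which sends at most [2 * #|C| + 2]. *)
Lemma lenz_three_outside (T : finType) (e : rel T) (L C W : {set T}) :
  lenz_pair e L C -> W \subset ~: (L :|: C) -> #|W| = 3 ->
  (forall x, #|T| <= 2 * (#|out e x| + #|inn e x|)) ->
  3 * #|T| <= 4 * #|C| + 34 + 12 * #|~: (L :|: C)|.
Proof.
move=> LC WQ W3 deg; set Q := ~: (L :|: C) in WQ *.
have dLC := lenz_disj LC.
have h1 : \sum_(q in W) #|inn e q :&: C| <= 2 * #|C| + 2.
  rewrite -double_count.
  (* All but at most two [p] in [C] miss a vertex of [W]. *)
  apply: (@leq_trans (\sum_(p in C) (2 + (W \subset out e p)))).
    apply: leq_sum => p _; case: (boolP (W \subset out e p)) => [_|nW].
      by rewrite addn1 -W3 subset_leq_card // subsetIr.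
    rewrite addn0 -ltnS -W3; apply: proper_card.
    by rewrite properE subsetIr /= subsetI subxx andbT.
  rewrite big_split /= sum_nat_const mulnC leq_add2l.
  have -> : \sum_(p in C) (W \subset out e p) = #|[set p | W \subset out e p] :&: C|.
    by rewrite card_set_sum; apply: eq_bigr => p _; rewrite inE.
  rewrite leqNgt; apply/negP => /card_subset_exact[P PC P3].
  have := lenz_K33 LC (subset_trans PC (subsetIr _ _)) P3.
  suff : W \subset [set q | P \subset inn e q].
    by move=> /subset_leq_card; rewrite W3 => /leq_trans h /h.
  apply/subsetP => q qW; rewrite inE; apply/subsetP => p /(subsetP PC).
  by rewrite !inE => /andP[/subsetP/(_ _ qW)]; rewrite inE.
have h2 : \sum_(q in W) #|T| <= \sum_(q in W) (2 * #|inn e q :&: C| + 2 * (5 + 2 * #|Q|)).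
  apply: leq_sum => q /(subsetP WQ); rewrite in_setC in_setU negb_or => /andP[qL qC].
  have := deg q.
  rewrite (out_card_split (out e q) dLC) (out_card_split (inn e q) dLC) -/Q.
  have := lenz_outL LC q; have := lenz_outC LC qL; have := lenz_inL LC qC.
  have := subset_leq_card (subsetIr (out e q) Q).
  have := subset_leq_card (subsetIr (inn e q) Q).
  lia.
move: h2; rewrite big_split /= !sum_nat_const W3 -big_distrr /=.
lia.
Qed.

(** [L] sends at most one edge to each vertex off [C]; a vertex off [L] sends at most two edges to
    [L] and two to [C]. *)
Lemma nedges_lenz (T : finType) (e : rel T) (L C : {set T}) :
  lenz_pair e L C -> irreflexive e ->
  nedges e <= #|C| * #|L| + 4 * #|C| + #|L| + #|~: (L :|: C)| * #|C|
    + 4 * #|~: (L :|: C)| + #|~: (L :|: C)| * #|~: (L :|: C)|.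
Proof.
move=> LC irr; set Q := ~: (L :|: C).
set a := #|C|; set b := #|L|; set k := #|Q|; have dLC := lenz_disj LC.
have splitT (F : T -> nat) :
    \sum_v F v = \sum_(v in L) F v + \sum_(v in C) F v + \sum_(v in Q) F v.
  rewrite (bigID (mem L)) /= -addnA; congr (_ + _).
  rewrite (bigID (mem C)) /=; congr (_ + _); apply: eq_bigl => v; rewrite ?inE ?negb_or //.
  by case: (boolP (v \in C)) => vC; rewrite ?andbF //= (disjointFl dLC vC).
have outs x : #|out e x| = #|out e x :&: L| + #|out e x :&: C| + #|out e x :&: Q|.
  exact: out_card_split.
have outL : \sum_(x in L) #|out e x| <= a * b + b + k.
  rewrite double_countT splitT.
  have hC : \sum_(y in C) #|inn e y :&: L| <= a * b.
    by apply: sum_le_const => y _; apply: subset_leq_card; exact: subsetIr.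
  have hQ : \sum_(y in Q) #|inn e y :&: L| <= k * 1.
    apply: sum_le_const => y /=.
    by rewrite !inE negb_or => /andP[_ /(lenz_inL LC)].
  have hL : \sum_(y in L) #|inn e y :&: L| <= b * 1.
    by apply: sum_le_const => y yL; apply: (lenz_inL LC); rewrite (disjointFr dLC yL).
  lia.
have outC : \sum_(x in C) #|out e x| <= a * (4 + k).
  apply: sum_le_const => x xC; rewrite outs.
  have xL : x \notin L by rewrite (disjointFl dLC xC).
  have := lenz_outL LC x; have := lenz_outC LC xL.
  have := subset_leq_card (subsetIr (out e x) Q).
  rewrite /k; lia.
have outQ : \sum_(x in Q) #|out e x| <= k * (4 + k.-1).
  apply: sum_le_const => x xQ; rewrite outs.
  have xL : x \notin L by move: xQ; rewrite !inE negb_or => /andP[].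
  have := lenz_outL LC x; have := lenz_outC LC xL.
  have : out e x :&: Q \subset Q :\ x.
    apply/subsetP => y; rewrite !inE => /andP[exy ->]; rewrite andbT.
    by apply: contraTneq exy => ->; rewrite irr.
  move=> /subset_leq_card; have := cardsD1 x Q; rewrite xQ /k.
  lia.
rewrite /nedges splitT.
have : k * (4 + k.-1) + k = 4 * k + k * k by case: (k) => [|k']; nia.
move: outL outC outQ; lia.
Qed.

(* Greedy form of the Kovari-Sos-Turan argument: each new vertex of [A] keeps at
   least a sixteenth of the current common out-neighbours. *)
Lemma complete_bipartite_step (T : finType) (e : rel T) (Y : {set T}) j :
  16 * j <= #|T| -> 0 < #|T| ->
  (forall y, y \in Y -> #|T| <= 8 * #|inn e y|) ->
  exists A : {set T}, #|A| = j /\ #|Y| <= #|[set y in Y | A \subset inn e y]| * 16 ^ j.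
Proof.
elim: j => [|j IH] jT T0 Ydeg.
  exists set0; rewrite cards0 expn0 muln1; split=> //.
  by apply: subset_leq_card; apply/subsetP => y yY; rewrite inE yY sub0set.
have [|A [Aj AY]] := IH _ T0 Ydeg; first by lia.
set Z := [set y in Y | _] in AY.
have [/existsP[x /andP[xA hx]]|/existsPn none] :=
    boolP [exists x, (x \notin A) && (#|Z| <= 16 * #|out e x :&: Z|)].
  exists (x |: A); rewrite cardsU1 xA Aj; split=> //.
  apply: leq_trans AY _; rewrite expnS mulnA leq_mul2r; apply/orP; right.
  rewrite mulnC in hx; apply: leq_trans hx _; rewrite leq_mul2r; apply/orP; right.
  apply: subset_leq_card; apply/subsetP => y; rewrite !inE => /and3P[exy -> Ay] /=.
  by rewrite subUset Ay sub1set inE exy.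
have [Z0|Z0] := posnP #|Z|.
  have Y0 : #|Y| = 0 by move: AY; rewrite Z0; lia.
  have [|A' _ A'j] := @card_subset_exact T [set: T] j.+1.
    by rewrite cardsT; lia.
  by exists A'; rewrite Y0.
(* If no vertex works, fewer than [#|T| * #|Z| / 16] edges enter [Z] from outside [A], yet each [y]
   in [Z] has at least [#|T| / 8 - j], hence [#|T| / 16], in-neighbours there. *)
have : \sum_(x in ~: A) 16 * #|out e x :&: Z| <= #|~: A| * #|Z|.-1.
  apply: sum_le_const => x /=; rewrite inE => xA.
  have := none x; rewrite xA /= -ltnNge; lia.
rewrite -big_distrr /= double_count.
have : \sum_(y in Z) (#|T| - 8 * j) <= \sum_(y in Z) 8 * #|inn e y :&: ~: A|.
  apply: leq_sum => y; rewrite inE => /andP[yY Ay].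
  have := Ydeg y yY; rewrite -(cardsID A (inn e y)) -setDE.
  have : #|inn e y :&: A| <= j by rewrite -Aj; apply: subset_leq_card; exact: subsetIr.
  lia.
rewrite -big_distrr /= sum_nat_const.
have := max_card (mem (~: A)).
set u := \sum_(_ in _) _; set w := #|~: A|; set z := #|Z| in Z0 *; set n := #|T| in T0 jT *.
move: (n) T0 jT (z) Z0 (w) (u) => {}n T0 jT {}z Z0 {}w {}u wn h1 h2.
exfalso.
have lt : 16 * u < n * z.
  case: z Z0 h1 h2 => // z _ _ h2; apply: leq_ltn_trans h2 _.
  apply: (@leq_ltn_trans (n * z)); first by rewrite leq_mul2r wn orbT.
  by rewrite ltn_pmul2l.
have : z * (n - 8 * j) * 2 >= z * n by rewrite -mulnA leq_mul2l; lia.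
lia.
Qed.

Lemma complete_bipartite (s t : nat) : exists N : nat,
  forall (T : finType) (e : rel T), N <= #|T| ->
  #|T| * #|T| <= 4 * nedges e ->
  exists A B : {set T}, [/\ #|A| = s, #|B| = t &
    forall x y, x \in A -> y \in B -> e x y].
Proof.
(* The terms allow for [s] greedy steps, for [t] survivors of [#|T| / 8] vertices after [s] losses
   of a factor 16, and for a nonempty graph. *)
exists (16 * s + 8 * t * 16 ^ s + 1) => T e nT he.
pose Y := [set y | #|T| <= 8 * #|inn e y|].
(* Vertices outside [Y] receive at most half of the [#|T| ^ 2 / 4] edges that are guaranteed. *)
have hY : #|T| <= 8 * #|Y|.
  have : \sum_y 8 * #|inn e y| <= #|Y| * (8 * #|T|) + #|T| * #|T|.
    rewrite (bigID (mem Y)) /=; apply: leq_add.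
      by apply: sum_le_const => y _; rewrite leq_mul2l max_card.
    apply: (@leq_trans (#|[predC Y]| * #|T|)); last by rewrite leq_mul2r max_card orbT.
    by apply: sum_le_const => y /=; rewrite !inE -ltnNge => /ltnW.
  rewrite -big_distrr /= -nedges_inn => h; have : 0 < #|T| by lia.
  move: (nedges e) (#|T|) (#|Y|) he h => u n y; nia.
have [||y|A [As AY]] := @complete_bipartite_step T e Y s; rewrite ?inE //; try lia.
have [|B BY Bt] := @card_subset_exact T [set y in Y | A \subset inn e y] t.
  have : 0 < 16 ^ s by rewrite expn_gt0.
  move: (#|[set y in Y | _]|) AY => z; move: (16 ^ s) nT => c; nia.
exists A, B; split=> // x y xA /(subsetP BY); rewrite !inE => /andP[_ /subsetP/(_ _ xA)].
by rewrite inE.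
Qed.

(** The constant 49 is what [nedges_lenz] yields with two outside vertices when [#|C|] exceeds
    [#|L|] by 5. *)
Lemma lenz_rel_nedges : exists M : nat,
  forall (T : finType) (e : rel T), M <= #|T| ->
  irreflexive e -> lenz_rel e ->
  (forall x, #|T| <= 2 * (#|out e x| + #|inn e x|)) ->
  4 * nedges e <= #|T| * #|T| + 10 * #|T| + 49.
Proof.
(* With 200, [lenz_big] leaves at most [0.035 * #|T|] outside vertices up to a constant, few enough
   to contradict [lenz_three_outside]. *)
have [N HN] := complete_bipartite 200 200.
exists (N + 'C(200, 3) + 100) => T e nT irr le deg.
have he : #|T| * #|T| <= 4 * nedges e.
  rewrite -sum_nat_const (_ : 4 * _ = 2 * (nedges e + nedges e)); last lia.
  by rewrite {2}nedges_inn /nedges -big_split /= big_distrr /=; apply: leq_sum => x _.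
have [|A [B [As Bs AB]]] := HN T e _ he; first by lia.
have [||L [C [AL BC LC]]] := le A B _ _ AB; rewrite ?As ?Bs //.
have [h1 h2] := lenz_big LC AL BC As Bs deg.
have cardT : #|T| = #|L| + #|C| + #|~: (L :|: C)|.
  by rewrite -cardsT (out_card_split setT (lenz_disj LC)) !setTI.
have k2 : #|~: (L :|: C)| <= 2.
  rewrite leqNgt; apply/negP => /card_subset_exact[W WQ W3].
  have := lenz_three_outside LC WQ W3 deg.
  move: h1 h2 cardT nT; move: ('C(200, 3)) => K; lia.
have := nedges_lenz LC irr.
(* With [k] points outside, the bound exceeds four times the count by
   [(a - b - k - 3) ^ 2 + 40 - 12 * k - 4 * k ^ 2]. *)
have [+ _] := nat_Cauchy #|C| (#|L| + #|~: (L :|: C)| + 3); rewrite cardT -!mulnn.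
move: (nedges e) k2 => E; move: (#|~: _|) (#|L|) (#|C|) => k b a {h1 h2 he nT cardT}.
by case: k => [|[|[|]]] // _; lia.
Qed.

Local Open Scope ring_scope.

(** * Spheres, lines and circles *)

Definition cx (R : realType) (x : 'rV[R]_3) : R := x ord0 ord0.
Definition cy (R : realType) (x : 'rV[R]_3) : R := x ord0 (lift ord0 ord0).
Definition cz (R : realType) (x : 'rV[R]_3) : R :=
  x ord0 (lift ord0 (lift ord0 ord0)).

Definition sqdist (R : realType) (x y : 'rV[R]_3) : R :=
  (cx x - cx y) ^+ 2 + (cy x - cy y) ^+ 2 + (cz x - cz y) ^+ 2.

Lemma edistE (R : realType) (x y : 'rV[R]_3) : edist x y = Num.sqrt (sqdist x y).
Proof. by rewrite /edist !big_ord_recl big_ord0 addr0 addrA. Qed.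

Lemma sqdist_ge0 (R : realType) (x y : 'rV[R]_3) : 0 <= sqdist x y.
Proof. by rewrite !addr_ge0 ?sqr_ge0. Qed.

Lemma sqdistxx (R : realType) (x : 'rV[R]_3) : sqdist x x = 0.
Proof. by rewrite /sqdist !subrr expr0n !addr0. Qed.

Lemma edist_eq (R : realType) (x y : 'rV[R]_3) (r : R) : 0 <= r ->
  (edist x y == r) = (sqdist x y == r ^+ 2).
Proof.
move=> r0; rewrite edistE -(@eqrXn2 _ 2 _ r) ?sqrtr_ge0 //.
by rewrite sqr_sqrtr // sqdist_ge0.
Qed.

Lemma coordP (R : realType) (x y : 'rV[R]_3) :
  cx x = cx y -> cy x = cy y -> cz x = cz y -> x = y.
Proof.
move=> h0 h1 h2; apply/rowP => i.
case: (unliftP ord0 i) => [j|] -> //; case: (unliftP ord0 j) => [k|] -> //.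
by rewrite [k]ord1.
Qed.

Lemma parallelP (R : realType) (u w : 'rV[R]_3) : u != 0 ->
  cx u * cy w = cy u * cx w -> cy u * cz w = cz u * cy w ->
  cx u * cz w = cz u * cx w -> exists t, w = t *: u.
Proof.
move=> u0 hxy hyz hxz.
have n0 : sqdist u 0 != 0.
  apply: contra u0; rewrite /sqdist /cx /cy /cz !mxE !subr0.
  rewrite !paddr_eq0 ?addr_ge0 ?sqr_ge0 // !sqrf_eq0 => /andP[/andP[/eqP a /eqP b] /eqP c].
  by apply/eqP; apply: coordP; rewrite /cx /cy /cz !mxE.
exists ((cx u * cx w + cy u * cy w + cz u * cz w) / sqdist u 0).
move: n0 hxy hyz hxz; rewrite /sqdist /cx /cy /cz !mxE !subr0 => n0 hxy hyz hxz.
move: n0 hxy hyz hxz; set a := u _ _; set b := u _ _; set c := u _ _.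
set a' := w _ _; set b' := w _ _; set c' := w _ _ => n0 hxy hyz hxz.
have E v (e1 e2 : R) : e1 = e2 -> v * e1 = v * e2 by move=> ->.
have := (E a _ _ hxy, E b _ _ hxy, E b _ _ hyz, E c _ _ hyz, E a _ _ hxz, E c _ _ hxz).
move=> [[[[[h1 h2] h3] h4] h5] h6].
apply: coordP; rewrite /cx /cy /cz !mxE -/a -/b -/c -/a' -/b' -/c' mulrAC;
  apply: (canRL (mulfK n0)); lra.
Qed.

(** On the line, the squared distance to [o] is quadratic in [t] with leading coefficient
    [sqdist p1 p2], and it takes the same value at 0 and 1. *)
Lemma line_sphere (R : realType) (o p1 p2 : 'rV[R]_3) (t : R) :
  sqdist o p2 = sqdist o p1 ->
  sqdist o (p1 + t *: (p2 - p1)) = sqdist o p1 ->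
  p1 = p2 \/ p1 + t *: (p2 - p1) = p1 \/ p1 + t *: (p2 - p1) = p2.
Proof.
move=> h1 h2.
have : sqdist p1 p2 * (t * (t - 1)) = 0.
  move: h1 h2; rewrite /sqdist /cx /cy /cz !mxE => h1 h2.
  have E v (e1 e2 : R) : e1 = e2 -> v * e1 = v * e2 by move=> ->.
  by have := E t _ _ h1; lra.
move/eqP; rewrite !mulf_eq0 subr_eq0 => /or3P[|/eqP->|/eqP->].
- rewrite /sqdist !paddr_eq0 ?addr_ge0 ?sqr_ge0 // !sqrf_eq0 !subr_eq0.
  by move=> /andP[/andP[/eqP a /eqP b] /eqP c]; left; apply: coordP.
- by right; left; rewrite scale0r addr0.
- by right; right; rewrite scale1r addrC subrK.
Qed.

Definition pt (R : realType) (x y z : R) : 'rV[R]_3 := \row_(i < 3) [:: x; y; z]`_i.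

Lemma cx_pt (R : realType) (x y z : R) : cx (pt x y z) = x.
Proof. by rewrite /cx mxE. Qed.
Lemma cy_pt (R : realType) (x y z : R) : cy (pt x y z) = y.
Proof. by rewrite /cy mxE. Qed.
Lemma cz_pt (R : realType) (x y z : R) : cz (pt x y z) = z.
Proof. by rewrite /cz mxE. Qed.
Definition c_pt := (cx_pt, cy_pt, cz_pt).

Lemma cxB (R : realType) (x y : 'rV[R]_3) : cx (x - y) = cx x - cx y.
Proof. by rewrite /cx !mxE. Qed.
Lemma cyB (R : realType) (x y : 'rV[R]_3) : cy (x - y) = cy x - cy y.
Proof. by rewrite /cy !mxE. Qed.
Lemma czB (R : realType) (x y : 'rV[R]_3) : cz (x - y) = cz x - cz y.
Proof. by rewrite /cz !mxE. Qed.
Definition cB := (cxB, cyB, czB).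

(** Three distinct points of a sphere are not collinear, by [line_sphere]. Equidistance from them is
    then a pair of independent linear equations, whose solutions differ by multiples of the cross
    product [N]. *)
Lemma equidistant_line (R : realType) (o q1 q2 q3 p1 p2 p : 'rV[R]_3) :
  q1 != q2 -> q1 != q3 -> q2 != q3 ->
  sqdist o q2 = sqdist o q1 -> sqdist o q3 = sqdist o q1 ->
  sqdist p1 q2 = sqdist p1 q1 -> sqdist p1 q3 = sqdist p1 q1 ->
  sqdist p2 q2 = sqdist p2 q1 -> sqdist p2 q3 = sqdist p2 q1 ->
  sqdist p q2 = sqdist p q1 -> sqdist p q3 = sqdist p q1 ->
  p1 != p2 -> exists t, p = p1 + t *: (p2 - p1).
Proof.
move=> q12 q13 q23 o2 o3 p12 p13 p22 p23 pq2 pq3 p1p2.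
pose u := q2 - q1; pose w := q3 - q1.
pose N := pt (cy u * cz w - cz u * cy w) (cz u * cx w - cx u * cz w)
             (cx u * cy w - cy u * cx w).
have Nn0 : N != 0.
  apply/eqP => N0; have Nx : cx N = 0 by rewrite N0 /cx mxE.
  have Ny : cy N = 0 by rewrite N0 /cy mxE.
  have Nz : cz N = 0 by rewrite N0 /cz mxE.
  move: Nx Ny Nz; rewrite !c_pt => Nx Ny Nz.
  have u0 : u != 0 by rewrite subr_eq0 eq_sym.
  have [||| t wt] := parallelP (w := w) u0; [lra | lra | lra |].
  have q3t : q3 = q1 + t *: (q2 - q1) by rewrite -/u -wt addrC subrK.
  have := @line_sphere _ o q1 q2 t; rewrite -q3t => /(_ o2 o3) [|[|]] /eqP.
  - by rewrite (negPf q12).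
  - by rewrite eq_sym (negPf q13).
  - by rewrite eq_sym (negPf q23).
(* The triple product [d x (u x w) = (d . w) u - (d . u) w] vanishes. *)
have key (d : 'rV[R]_3) :
    cx d * cx u + cy d * cy u + cz d * cz u = 0 ->
    cx d * cx w + cy d * cy w + cz d * cz w = 0 -> exists t, d = t *: N.
  move=> du dw.
  have E v (e : R) : e = 0 -> v * e = 0 by move=> ->; rewrite mulr0.
  have := (E (cx u) _ dw, E (cy u) _ dw, E (cz u) _ dw).
  have := (E (cx w) _ du, E (cy w) _ du, E (cz w) _ du).
  move=> [[h1 h2] h3] [[h4 h5] h6].
  by apply: parallelP; rewrite // !c_pt; lra.
have perp (x y : 'rV[R]_3) : sqdist x q2 = sqdist x q1 -> sqdist x q3 = sqdist x q1 ->
    sqdist y q2 = sqdist y q1 -> sqdist y q3 = sqdist y q1 -> exists t, y - x = t *: N.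
  by rewrite /sqdist => x2 x3 y2 y3; apply: key; rewrite !cB; lra.
have [s ds] := perp _ _ p12 p13 p22 p23.
have [s' vs] := perp _ _ p12 p13 pq2 pq3.
have s0 : s != 0.
  by apply: contraNneq p1p2 => s0; rewrite eq_sym -subr_eq0 ds s0 scale0r.
exists (s' / s); rewrite ds scalerA mulfVK // -vs; by rewrite addrC subrK.
Qed.

(** The difference of the squared distances to [x] and [y] is an affine function of the point. *)
Lemma line_equidistant (R : realType) (p1 p2 x y : 'rV[R]_3) (t : R) :
  sqdist p1 x = sqdist p1 y -> sqdist p2 x = sqdist p2 y ->
  sqdist (p1 + t *: (p2 - p1)) x = sqdist (p1 + t *: (p2 - p1)) y.
Proof.
rewrite /sqdist /cx /cy /cz !mxE => h1 h2.
have E v (e1 e2 : R) : e1 = e2 -> v * e1 = v * e2 by move=> ->.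
have := (E (1 - t) _ _ h1, E t _ _ h2) => -[]; lra.
Qed.

Lemma sphere_lenz_rel (R : realType) (T : finType) (f : T -> 'rV[R]_3) (r : T -> R) :
  injective f -> (forall x, 0 < r x) ->
  lenz_rel (fun x y => edist (f x) (f y) == r x).
Proof.
move=> f_inj r0; pose e : rel T := fun x y => edist (f x) (f y) == r x.
change (lenz_rel e) => A B A3 B3 AB.
have eE x y : e x y = (sqdist (f x) (f y) == r x ^+ 2).
  by rewrite /e edist_eq // ltW.
have fneq x y : x != y -> f x != f y by apply: contra => /eqP/f_inj->.
have eqd x y z : e x y -> e x z -> sqdist (f x) (f z) = sqdist (f x) (f y).
  by rewrite !eE => /eqP-> /eqP->.
have [a1 [a2 [a3 [[a1A a2A _] [a12 _ _]]]]] := card_gt2P A3.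
have [b1 [b2 [b3 [[b1B b2B b3B] [b12 b23 b31]]]]] := card_gt2P B3.
rewrite eq_sym in b31.
(* Both sets are taken maximal, so that the bounds on vertices outside them can hold. *)
pose L := [set x | B \subset out e x]; pose C := [set y | A \subset inn e y].
have LB x b : x \in L -> b \in B -> e x b.
  by rewrite inE => /subsetP h /h; rewrite inE.
have AC a y : a \in A -> y \in C -> e a y.
  by move=> aA; rewrite inE => /subsetP/(_ _ aA); rewrite inE.
have AL : A \subset L.
  by apply/subsetP => a aA; rewrite inE; apply/subsetP => b bB; rewrite inE AB.
have BC : B \subset C.
  by apply/subsetP => b bB; rewrite inE; apply/subsetP => a aA; rewrite inE AB.
have lineB p1 p2 p : p1 \in L -> p2 \in L -> p \in L -> p1 != p2 ->
    exists t, f p = f p1 + t *: (f p2 - f p1).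
  move=> h1 h2 h h12.
  by apply: (@equidistant_line _ (f a1) (f b1) (f b2) (f b3));
    rewrite ?fneq //; apply: eqd; first [by apply: AB | by apply: LB].
(* Being equidistant from three points of [C], [f v] lies on the line through [f a1] and [f a2], and
   from that line all of [C] is equidistant. *)
have axis v c1 c2 c3 : c1 \in C -> c2 \in C -> c3 \in C ->
    c1 != c2 -> c1 != c3 -> c2 != c3 -> e v c1 -> e v c2 -> e v c3 ->
    forall y z, y \in C -> z \in C -> sqdist (f v) (f y) = sqdist (f v) (f z).
  move=> h1 h2 h3 h12 h13 h23 v1 v2 v3 y z yC zC.
  have [||||||||||||t ->] := @equidistant_line _ (f a1) (f c1) (f c2) (f c3)
      (f a1) (f a2) (f v); rewrite ?fneq //; try by apply: eqd => //; apply: AC.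
  by apply: line_equidistant; apply: eqd; apply: AC.
exists L, C; split=> //; split.
- rewrite disjoints_subset; apply/subsetP => x xL; rewrite inE; apply/negP => xC.
  have xb b : b \in B -> e x b by apply: LB.
  have BCP b : b \in B -> b \in C by move/(subsetP BC).
  have := @axis x b1 b2 b3 (BCP _ b1B) (BCP _ b2B) (BCP _ b3B) b12 b31 b23
    (xb _ b1B) (xb _ b2B) (xb _ b3B) x b1 xC (BCP _ b1B).
  move: (xb _ b1B); rewrite eE sqdistxx => /eqP-> /eqP.
  by rewrite eq_sym expf_eq0 (gt_eqF (r0 x)).
- move=> v; apply: contraNT; rewrite -ltnNge => /card_gt2P.
  move=> [c1 [c2 [c3 [[]]]]]; rewrite !inE.
  move=> /andP[v1 c1C] /andP[v2 c2C] /andP[v3 c3C] [c12 c23 c31].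
  rewrite eq_sym in c31; apply/subsetP => b bB; rewrite inE eE.
  have := @axis v c1 c2 c3; rewrite !inE => /(_ c1C c2C c3C c12 c31 c23 v1 v2 v3 b c1).
  rewrite !inE => -> //; first by rewrite -eE.
  by move/(subsetP BC): bB; rewrite inE.
- move=> v; rewrite leqNgt; apply/negP => /card_gt2P.
  move=> [x1 [x2 [x3 [[]]]]]; rewrite ![_ \in _ :&: _]inE ![_ \in out _ _]inE.
  move=> /andP[v1 x1L] /andP[v2 x2L] /andP[v3 x3L] [x12 x23 x31].
  have [t xt] := lineB _ _ _ x1L x2L x3L x12.
  have := @line_sphere _ (f v) (f x1) (f x2) t; rewrite -xt.
  move=> /(_ (eqd _ _ _ v1 v2) (eqd _ _ _ v1 v3)) [|[|]] /f_inj/eqP.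
  + by rewrite (negPf x12).
  + by rewrite (negPf x31).
  + by rewrite eq_sym (negPf x23).
(* Two points of the axis as far from [v] as from [b1] make every point of [A] so, which puts [v] in
   [C]. *)
- move=> v; apply: contraNT; rewrite -ltnNge => /card_gt1P.
  move=> [x [x' []]]; rewrite ![_ \in _ :&: _]inE ![_ \in inn _ _]inE.
  move=> /andP[xv xL] /andP[xv' xL'] xx'.
  rewrite inE; apply/subsetP => a aA; rewrite inE eE.
  have [t at_] := lineB _ _ _ xL xL' (subsetP AL _ aA) xx'.
  have -> : sqdist (f a) (f v) = sqdist (f a) (f b1).
    by rewrite at_; apply: line_equidistant; apply: eqd => //; apply: LB.
  by rewrite -eE AB.
(* A third common out-neighbour makes the points of [P] equidistant from three points of a sphere,
   hence collinear; but they also lie on the sphere about [a1]. *)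
- move=> P PC P3; rewrite leqNgt; apply/negP => /card_gt2P.
  move=> [q1 [q2 [q3 [[]]]]]; rewrite !inE => /subsetP Pq1 /subsetP Pq2 /subsetP Pq3.
  move=> [q12 q23 q31]; rewrite eq_sym in q31.
  have /card_gt2P[p1 [p2 [p3 [[p1P p2P p3P] [p12 p23 p31]]]]] : (2 < #|P|)%N by rewrite P3.
  have eP p : p \in P -> [/\ e p q1, e p q2 & e p q3].
    by move=> pP; move: (Pq1 _ pP) (Pq2 _ pP) (Pq3 _ pP); rewrite !inE.
  have [[? ? ?] [? ? ?] [? ? ?]] := And3 (eP _ p1P) (eP _ p2P) (eP _ p3P).
  have [||||||||||||t pt] := @equidistant_line _ (f p1) (f q1) (f q2) (f q3)
      (f p1) (f p2) (f p3); rewrite ?fneq //; try by apply: eqd.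
  have aP p : p \in P -> e a1 p by move/(subsetP PC); apply: AC.
  have := @line_sphere _ (f a1) (f p1) (f p2) t; rewrite -pt.
  move=> /(_ (eqd _ _ _ (aP _ p1P) (aP _ p2P)) (eqd _ _ _ (aP _ p1P) (aP _ p3P))).
  move=> [|[|]] /f_inj/eqP.
  + by rewrite (negPf p12).
  + by rewrite (negPf p31).
  + by rewrite eq_sym (negPf p23).
Qed.

(** * The upper bound *)

Lemma num_fav_edgesE (R : realType) (S : {fset 'rV[R]_3}) (r : 'rV[R]_3 -> R) :
  num_fav_edges S r = (\sum_(x <- S) \sum_(y <- S) (edist x y == r x))%N.
Proof.
rewrite /num_fav_edges /fav_edges card_fset_sum1 -big_fset_condE /=.
rewrite (perm_big (allpairs pair S S)) /=; last first.
  apply: uniq_perm; rewrite ?fset_uniq ?allpairs_uniq ?fset_uniq //.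
    by move=> [x y] [x' y'].
  move=> [x y]; rewrite inE /=; apply/andP/allpairsP => [[xS yS]|[[x' y'] [? ? [-> ->]]]] //.
  by exists (x, y).
rewrite big_mkcond big_allpairs /=.
by apply: eq_bigr => x _; apply: eq_bigr => y _; case: eqP.
Qed.

Lemma num_fav_edgesD1 (R : realType) (S : {fset 'rV[R]_3}) (r : 'rV[R]_3 -> R) v :
  v \in S ->
  (num_fav_edges S r <= num_fav_edges (S `\ v)%fset r +
     (\sum_(y <- S) (edist v y == r v) + \sum_(x <- S) (edist x v == r x)))%N.
Proof.
move=> vS; rewrite !num_fav_edgesE (big_fsetD1 v) //= addnCA leq_add2l.
rewrite [X in (_ <= _ + X)%N](big_fsetD1 v) //= addnCA -big_split /=.
apply: leq_trans (leq_addl _ _); apply: leq_sum => x _.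
by rewrite (big_fsetD1 v) //= addnC.
Qed.

Lemma num_fav_edges_nedges (R : realType) (S : {fset 'rV[R]_3}) (r : 'rV[R]_3 -> R) :
  num_fav_edges S r = nedges (fun x y : S => edist (val x) (val y) == r (val x)).
Proof.
rewrite num_fav_edgesE big_seq_fsetE; apply: eq_bigr => x _.
rewrite big_seq_fsetE -sum1_card [RHS]big_mkcond.
by apply: eq_bigr => y _; rewrite inE; case: eqP.
Qed.

Lemma num_fav_edges_le : exists n0 : nat, forall (R : realType) (S : {fset 'rV[R]_3})
    (r : 'rV[R]_3 -> R), (n0 <= #|` S|)%N -> {in S, forall x, 0 < r x} ->
  (4 * num_fav_edges S r <= #|` S| * #|` S| + 10 * #|` S| + 49)%N.
Proof.
(* The slack [K - m] covers the sets of at most [M] points by the trivial bound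
   and vanishes for [K <= m]. *)
have [M HM] := lenz_rel_nedges; pose K := (4 * (M * M) + M)%N.
suff main (R : realType) (r : 'rV[R]_3 -> R) m (S : {fset 'rV[R]_3}) : #|` S| = m ->
    {in S, forall x, 0 < r x} ->
    (4 * num_fav_edges S r <= m * m + 10 * m + 49 + (K - m))%N.
  exists K => R S r hS r0; have := main R r _ S erefl r0; lia.
elim: m S => [|m IH] S Sm r0.
  rewrite num_fav_edgesE; have /eqP := Sm; rewrite cardfs_eq0 => /eqP->.
  by rewrite big_seq_fset0.
have [mM|Mm] := ltnP m.+1 M.
  have : (num_fav_edges S r <= m.+1 * m.+1)%N.
    rewrite num_fav_edgesE.
    apply: (@leq_trans (\sum_(x <- S) \sum_(y <- S) 1)).
      by apply: leq_sum => x _; apply: leq_sum => y _; case: eqP.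
    by rewrite -card_fset_sum1 big_const_seq count_predT iter_addn_0 Sm.
  rewrite /K; nia.
pose e := fun x y : S => edist (val x) (val y) == r (val x).
have rS (x : S) : 0 < r (val x) by apply: r0; apply: fsvalP.
have cardS : #|{: S}| = m.+1 by rewrite -cardfE.
have [/forallP deg|] := boolP [forall x : S, #|{: S}| <= 2 * (#|out e x| + #|inn e x|)]%N.
  have := HM _ e; rewrite cardS num_fav_edges_nedges -/e => /(_ Mm) h.
  apply: leq_trans (h _ _ _) (leq_addr _ _).
  - move=> x; rewrite /e edistE sqdistxx sqrtr0; apply: lt_eqF; exact: rS.
  - by apply: sphere_lenz_rel => //; exact: val_inj.
  - by move=> x; rewrite -cardS.
rewrite negb_forall => /existsP[v]; rewrite -ltnNge cardS.
have -> : #|out e v| = (\sum_(y <- S) (edist (val v) y == r (val v)))%N.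
  rewrite big_seq_fsetE -sum1_card big_mkcond.
  by apply: eq_bigr => y _; rewrite inE /e; case: eqP.
have -> : #|inn e v| = (\sum_(x <- S) (edist x (val v) == r x))%N.
  rewrite big_seq_fsetE -sum1_card big_mkcond.
  by apply: eq_bigr => y _; rewrite inE /e; case: eqP.
have vS : val v \in S by apply: fsvalP.
have := num_fav_edgesD1 r vS.
have Sv : #|` (S `\ val v)%fset| = m.
  by have := cardfsD1 (val v) S; rewrite vS Sm => -[].
have r0v : {in (S `\ val v)%fset, forall x, 0 < r x}.
  by move=> x; rewrite !inE => /andP[_ /r0].
(* Four times the degree sum of [v] is below [2 * (m + 1)]; the main term grows by [2 * m + 11] and
   the slack drops by at most 1. *)
have := IH _ Sv r0v; rewrite /K.
lia.
Qed.

(** * The construction *)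

(** With a list of points and squared radii, the construction reduces to polynomial identities in
    coordinates. *)
Lemma f3_ge_seq (R : realType) (s : seq 'rV[R]_3) (q : 'rV[R]_3 -> R) :
  uniq s -> {in s, forall x, 0 < q x} ->
  (\sum_(x <- s) count (fun y => sqdist x y == q x) s <= f3 R (size s))%N.
Proof.
move=> us q0; pose S : {fset 'rV[R]_3} := [fset x in s]%fset.
have Ss : perm_eq S s.
  by apply: uniq_perm => // x; rewrite inE.
have [_ ub] := f3P R (size s).
suff <- : num_fav_edges S (fun x => Num.sqrt (q x)) =
    (\sum_(x <- s) count (fun y => sqdist x y == q x) s)%N.
  rewrite -leEnat; apply: ub; exists S, (fun x => Num.sqrt (q x)); split=> //.
    by rewrite (perm_size Ss).
  by move=> x; rewrite inE => xs; rewrite sqrtr_gt0 q0.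
rewrite num_fav_edgesE (perm_big _ Ss) big_seq [RHS]big_seq.
apply: eq_bigr => x xs; rewrite (perm_big _ Ss) -sum1_count [RHS]big_mkcond.
apply: eq_bigr => y _.
by rewrite edistE eqr_sqrt ?sqdist_ge0 ?ltW ?q0 //; case: eqP.
Qed.

Lemma size_le_count (T : eqType) (P : pred T) (l s : seq T) :
  uniq l -> all (fun x => (x \in s) && P x) l -> (size l <= count P s)%N.
Proof.
move=> ul /allP ls; rewrite -size_filter; apply: uniq_leq_size => // x /ls.
by rewrite mem_filter andbC.
Qed.

Lemma uniq_flatten_map (T U : eqType) (F : T -> seq U) (s : seq T) :
  uniq s -> {in s, forall x, uniq (F x)} ->
  {in s &, forall x y, x != y -> ~~ has (mem (F x)) (F y)} ->
  uniq (flatten (map F s)).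
Proof.
elim: s => //= x s IH /andP[xs us] uF dF; rewrite cat_uniq uF ?mem_head //=.
rewrite IH // ?andbT; first last.
- by move=> y z ys zs; apply: dF; rewrite inE ?ys ?zs orbT.
- by move=> y ys; apply: uF; rewrite inE ys orbT.
apply/hasPn => p /flatten_mapP[y ys py]; apply/negP => px.
have xy : x != y by apply: contraNneq xs => ->.
have /hasPn/(_ p py) := dF x y (mem_head _ _) (mem_behead (s := x :: s) ys) xy.
by rewrite /= px.
Qed.

(** * Squares on the unit circle and heights on its axis *)

Definition square (R : realType) (p : R * R) : seq (R * R) :=
  [:: p; (- p.2, p.1); (- p.1, - p.2); (p.2, - p.1)].

Definition circle_pt (R : realType) (p : R * R) : 'rV[R]_3 := pt p.1 p.2 0.
Definition axis_pt (R : realType) (h : R) : 'rV[R]_3 := pt 0 0 h.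

Lemma sqdist_circle (R : realType) (p p' : R * R) :
  sqdist (circle_pt p) (circle_pt p') = (p.1 - p'.1) ^+ 2 + (p.2 - p'.2) ^+ 2.
Proof. by rewrite /sqdist !c_pt; ring. Qed.

Lemma sqdist_circle_axis (R : realType) (p : R * R) h :
  p.1 ^+ 2 + p.2 ^+ 2 = 1 -> sqdist (circle_pt p) (axis_pt h) = 1 + h ^+ 2.
Proof. by rewrite /sqdist !c_pt => <-; ring. Qed.

Lemma sqdist_axis_circle (R : realType) (p : R * R) h :
  p.1 ^+ 2 + p.2 ^+ 2 = 1 -> sqdist (axis_pt h) (circle_pt p) = 1 + h ^+ 2.
Proof. by rewrite /sqdist !c_pt => <-; ring. Qed.

Lemma sqdist_axis (R : realType) (h h' : R) :
  sqdist (axis_pt h) (axis_pt h') = (h - h') ^+ 2.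
Proof. by rewrite /sqdist !c_pt; ring. Qed.

(** The squares are orbits of the quarter turn, and the half-open quadrant is a fundamental domain
    for it. *)
Lemma uniq_squares (R : realType) (s : seq (R * R)) :
  uniq s -> {in s, forall p, 0 < p.1 /\ 0 <= p.2} ->
  uniq (flatten (map (@square R) s)).
Proof.
move=> us s0; apply: uniq_flatten_map => //.
  move=> [x y] /s0 /= [x0 y0]; rewrite /= !inE !xpair_eqE /=.
  have -> : (x == - y) = false by apply/eqP; lra.
  have -> : (x == - x) = false by apply/eqP; lra.
  have -> : (y == - x) = false by apply/eqP; lra.
  have -> : (- x == y) = false by apply/eqP; lra.
  by rewrite /= ?andbF.
move=> [x y] [x' y'] /s0 /= [x0 y0] /s0 /= [x0' y0'] ne.
apply: contra ne; rewrite /= !inE !xpair_eqE /= orbF => h.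
suff [-> ->] : x = x' /\ y = y' by rewrite !eqxx.
by move: h; do ![case/orP]; case/andP => /eqP h1 /eqP h2; split; lra.
Qed.

(* From height [h], the points [h +- sqrt (1 + h ^ 2)] of the axis are as far as the
   unit circle. *)
Fixpoint axis_height (R : realType) (i : nat) : R :=
  if i is j.+1 then axis_height R j + Num.sqrt (1 + axis_height R j ^+ 2) else 0.

Lemma axis_heightS (R : realType) i :
  (axis_height R i - axis_height R i.+1) ^+ 2 = 1 + axis_height R i ^+ 2.
Proof.
by rewrite /= opprD addNKr sqrrN sqr_sqrtr // addr_ge0 // sqr_ge0.
Qed.

Lemma axis_height1 (R : realType) : axis_height R 1 = 1.
Proof. by rewrite /= expr0n addr0 sqrtr1 add0r. Qed.

Lemma axis_height_mono (R : realType) : {homo axis_height R : i j / (i < j)%N >-> i < j}.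
Proof.
apply: homo_ltn => [x y z|i]; first exact: lt_trans.
by rewrite /= ltrDl sqrtr_gt0 ltr_wpDr ?sqr_ge0.
Qed.

Lemma size_squares (R : realType) (s : seq (R * R)) :
  size (flatten (map (@square R) s)) = (4 * size s)%N.
Proof. by elim: s => //= p s ->; rewrite mulnS. Qed.

Lemma square_norm (R : realType) (p p' : R * R) :
  p' \in square p -> p.1 ^+ 2 + p.2 ^+ 2 = 1 -> p'.1 ^+ 2 + p'.2 ^+ 2 = 1.
Proof.
by rewrite !inE => /or4P[] /eqP-> <- /=; ring.
Qed.

Lemma square_rot (R : realType) (p p' : R * R) : p' \in square p ->
  (- p'.2, p'.1) \in square p /\ (p'.2, - p'.1) \in square p.
Proof.
by rewrite ![p' \in _]inE => /or4P[] /eqP-> /=;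
  rewrite ?opprK -?surjective_pairing !inE !eqxx ?orbT.
Qed.

(* Multiplication by [u = (1/3, 2w/3)] and by its conjugate, as unit complex numbers;
   [(4w/9, 7/9)] is [u ^ 2] turned by a right angle into the first quadrant. *)
Lemma square_turn (R : realType) (w : R) (p : R * R) : w ^+ 2 = 2 ->
  p \in square (1 / 3, 2 * w / 3) ->
  (p.1 / 3 - p.2 * (2 * w / 3), p.1 * (2 * w / 3) + p.2 / 3)
     \in square (4 * w / 9, 7 / 9) /\
  (p.1 / 3 + p.2 * (2 * w / 3), p.2 / 3 - p.1 * (2 * w / 3)) \in square (1, 0).
Proof.
move=> w2.
have pairE (x y x' y' : R) : x = x' -> y = y' -> (x, y) == (x', y').
  by move=> -> ->.
rewrite ![p \in _]inE => /or4P[] /eqP->; rewrite /= !inE; split; apply/or4P.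
- by apply: Or42; apply: pairE => /=; lra.
- by apply: Or41; apply: pairE => /=; lra.
- by apply: Or43; apply: pairE => /=; lra.
- by apply: Or42; apply: pairE => /=; lra.
- by apply: Or44; apply: pairE => /=; lra.
- by apply: Or43; apply: pairE => /=; lra.
- by apply: Or41; apply: pairE => /=; lra.
- by apply: Or44; apply: pairE => /=; lra.
Qed.

(** The residue of [a] modulo 4 is made up by vertices of the square at [u], whose neighbours are in
    the squares at [(1, 0)] and [v]; these two take 8 points. All other points belong to complete
    squares. *)
Lemma circle_config (R : realType) (a : nat) : (8 <= a)%N ->
  exists (cs : seq (R * R)) (q : R * R -> R),
  [/\ uniq cs, size cs = a, {in cs, forall p, p.1 ^+ 2 + p.2 ^+ 2 = 1},
      {in cs, forall p, q p = 2 \/ q p = 4 / 3} &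
      {in cs, forall p : R * R, (1 < count (fun p' : R * R =>
        (p.1 - p'.1) ^+ 2 + (p.2 - p'.2) ^+ 2 == q p)%R cs)%N}].
Proof.
move=> a8; pose n := ((a - 8) %/ 4)%N; pose j := ((a - 8) %% 4)%N.
have aE : a = (4 * n + 8 + j)%N by rewrite /n /j; lia.
have j4 : (j < 4)%N by rewrite ltn_mod.
pose w : R := Num.sqrt 2; have w2 : w ^+ 2 = 2 by rewrite sqr_sqrtr.
have w0 : 0 < w by rewrite sqrtr_gt0.
have w1 : 1 < w by rewrite -(@ltr_pXn2r _ 2) ?nnegrE ?ltW // expr1n w2; lra.
pose u : R * R := (1 / 3, 2 * w / 3).
pose v : R * R := (4 * w / 9, 7 / 9).
(* Second coordinates of at most [1 / 2], positive and distinct, separate these base points from one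
   another and from [(1, 0)], [v] and [u]. *)
pose c i : R := i.+2%:R^-1; pose t i : R * R := (Num.sqrt (1 - c i ^+ 2), c i).
have c0 i : 0 < c i by rewrite invr_gt0 ltr0n.
have c12 i : c i <= 1 / 2.
  by rewrite /c mul1r lef_pV2 ?posrE ?ltr0n // ler_nat.
have c1 i : 0 < 1 - c i ^+ 2 by have := c0 i; have := c12 i; nra.
pose bs : seq (R * R) := [:: (1, 0), v & [seq t i | i <- iota 0 n]].
have bs_norm p : p \in u :: bs -> p.1 ^+ 2 + p.2 ^+ 2 = 1.
  rewrite !inE => /or4P[/eqP->|/eqP->|/eqP->|/mapP[i _ ->]] /=; try nra.
  by rewrite sqr_sqrtr ?subrK // ltW.
have bs_pos : {in u :: bs, forall p, 0 < p.1 /\ 0 <= p.2}.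
  move=> p; rewrite !inE => /or4P[/eqP->|/eqP->|/eqP->|/mapP[i _ ->]] /=; try by split; lra.
  by rewrite sqrtr_gt0; split=> //; apply: ltW.
have bs_uniq : uniq (u :: bs).
  have c_inj : injective c by move=> i i' /invr_inj/eqP; rewrite eqr_nat => /eqP[].
  apply: (@map_uniq _ _ snd); rewrite /= -map_comp (map_inj_uniq c_inj) iota_uniq andbT.
  have cN y : y <= 0 \/ 1 / 2 < y -> y \notin [seq (snd \o t) i | i <- iota 0 n].
    by move=> yP; apply/mapP => -[i _ e]; move: yP (c0 i) (c12 i); rewrite e /=; lra.
  rewrite !inE !negb_or !cN ?andbT; [|right; lra|by left|right; lra].
  by rewrite -andbA; apply/and3P; split; apply/eqP; nra.
pose F := flatten (map (@square R) bs).
pose cs := take j (square u) ++ F.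
have cs_norm p : p \in cs -> p.1 ^+ 2 + p.2 ^+ 2 = 1.
  rewrite mem_cat => /orP[/mem_take pu|/flatten_mapP[p' p'b]].
    by apply: (square_norm pu); apply: bs_norm; rewrite mem_head.
  by move/square_norm; apply; apply: bs_norm; rewrite inE p'b orbT.
have cs_uniq : uniq cs.
  apply: (subseq_uniq _ (uniq_squares bs_uniq bs_pos)).
  by rewrite cat_subseq // take_subseq.
have cs_size : size cs = a.
  by rewrite size_cat size_takel ?size_squares /= ?size_map ?size_iota; lia.
have mem_cs b0 p : b0 \in bs -> p \in square b0 -> p \in cs.
  by move=> b0s pb; rewrite mem_cat; apply/orP; right; apply/flatten_mapP; exists b0.
exists cs, (fun p => if p \in square u then 4 / 3 else 2); split=> //.
  by move=> p _; case: ifP => _; [right | left].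
move=> p pcs; have p1 := cs_norm _ pcs.
case: ifP => [pu|pNu].
  have [pv pe] := square_turn w2 pu; move: p pv pe p1 {pu pcs} => [x y] /=.
  have z2 : (2 * w / 3) ^+ 2 = 8 / 9 by lra.
  have z0 : 2 * w / 3 != 0 by apply/eqP; lra.
  move: (2 * w / 3) z2 z0 => z z2 z0 pv pe p1.
  apply: (@size_le_count _ _
    [:: (x / 3 - y * z, x * z + y / 3); (x / 3 + y * z, y / 3 - x * z)] cs); last first.
    rewrite /= (mem_cs _ _ _ pv) ?(mem_cs _ _ _ pe) ?inE ?eqxx ?orbT //= andbT.
    (* Here [4 / 9 + z ^ 2] is the squared chord of the rotation [u]. *)
    have n2 : (4 / 9 + z ^+ 2) * (x ^+ 2 + y ^+ 2) = 4 / 3 by rewrite p1 z2; lra.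
    by apply/andP; split; apply/eqP; rewrite /=; lra.
  rewrite /= inE andbT xpair_eqE; apply/negP => /andP[/eqP e1 /eqP e2].
  have /eqP : y * z = 0 by lra.
  have /eqP : x * z = 0 by lra.
  by rewrite !mulf_eq0 (negPf z0) !orbF => /eqP x0 /eqP y0; move: p1; rewrite x0 y0; lra.
have [b0 b0s pb] : exists2 b0, b0 \in bs & p \in square b0.
  apply/flatten_mapP; move: pcs; rewrite mem_cat => /orP[/mem_take|//].
  by rewrite pNu.
have [pl pr] := square_rot pb; move: p p1 pl pr {pNu pcs pb} => [x y] /= p1 pl pr.
apply: (@size_le_count _ _ [:: (- y, x); (y, - x)] cs); last first.
  rewrite /= (mem_cs _ _ b0s pl) (mem_cs _ _ b0s pr) /=.
  by rewrite andbT /=; apply/andP; split; apply/eqP; lra.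
rewrite /= inE andbT xpair_eqE; apply/negP => /andP[/eqP e1 /eqP e2].
have y0 : y = 0 by lra.
have x0 : x = 0 by lra.
by move: p1; rewrite x0 y0; lra.
Qed.

(** The [b - 1] edges: 0 reaches 1 and -1, [g] and [- g] reach each other, and each of the [m + 1]
    positive heights [h] but the last reaches the next. *)
Lemma axis_config (R : realType) (b : nat) : (5 <= b)%N ->
  exists (hs : seq R) (g : R),
  [/\ uniq hs, size hs = b, 0 < g /\ g ^+ 2 = 1 / 3,
      {subset [:: 1; - 1; g; - g] <= hs} &
      (b <= (\sum_(k <- hs) count (fun k' => (k - k') ^+ 2 == 1 + k ^+ 2)%R hs).+1)%N].
Proof.
move=> b5; pose m := (b - 5)%N; have bE : b = (m.+1 + 4)%N by rewrite /m; lia.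
pose g : R := Num.sqrt (1 / 3); have g2 : g ^+ 2 = 1 / 3 by rewrite sqr_sqrtr //; lra.
have g0 : 0 < g by rewrite sqrtr_gt0; lra.
have g1 : g < 1 by rewrite -(@ltr_pXn2r _ 2) ?nnegrE ?ltW // expr1n g2; lra.
pose h := axis_height R.
have h1 : h 1%N = 1 by apply: axis_height1.
have h_lt : {homo h : i i' / (i < i')%N >-> i < i'} by apply: axis_height_mono.
have hS i : (h i - h i.+1) ^+ 2 = 1 + h i ^+ 2 by apply: axis_heightS.
clearbody h.
have [hl hlE] : exists hl, hl = [seq h i.+1 | i <- iota 0 m.+1] by eexists.
have [hs hsE] : exists hs, hs = [:: 0, -1, g, - g & hl] by eexists.
have h_ge1 i : 1 <= h i.+1 by rewrite -h1 (ltW_homo h_lt).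
have hs_size : size hs = b by rewrite hsE /= hlE size_map size_iota; lia.
have hs_uniq : uniq hs.
  have h_inj : injective (h \o succn).
    move=> i i' /= e; case: (ltngtP i i') => // lt.
      by have := h_lt i.+1 i'.+1 lt; rewrite e ltxx.
    by have := h_lt i'.+1 i.+1 lt; rewrite e ltxx.
  have hN y : y < 1 -> y \notin hl.
    by move=> y1; rewrite hlE; apply/mapP => -[i _ e]; move: y1; rewrite e ltNge h_ge1.
  have hl_uniq : uniq hl by rewrite hlE (map_inj_uniq h_inj) iota_uniq.
  have [i0 i1 i2 i3] : [/\ 0 \notin hl, -1 \notin hl, g \notin hl & - g \notin hl].
    by split; apply: hN; lra.
  rewrite hsE !cons_uniq hl_uniq !in_cons !negb_or i0 i1 i2 i3.
  by rewrite !andbT -!andbA; repeat (apply/andP; split); apply/eqP; lra.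
have mem_h i : (i <= m)%N -> h i.+1 \in hs.
  by move=> im; rewrite hsE !in_cons; apply/orP; right; apply/orP; right;
    apply/orP; right; apply/orP; right; rewrite hlE; apply/map_f; rewrite mem_iota.
have one_hs : 1 \in hs by rewrite -h1 mem_h.
have axis_count : (\sum_(k <- hs) (count (fun k' => (k - k') ^+ 2 == 1 + k ^+ 2)%R hs) >= m.+4)%N.
  rewrite {1}hsE !big_cons hlE big_map.
  have e0 : (2 <= count (fun k' => (0 - k') ^+ 2 == 1 + 0 ^+ 2)%R hs)%N.
    apply: (@size_le_count _ _ [:: h 1%N; - 1] hs).
      by rewrite /= h1 inE andbT; apply/eqP; lra.
    rewrite /= mem_h //= h1 hsE !in_cons eqxx ?orbT /= andbT.
    by apply/andP; split; apply/eqP; ring.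
  have eg : (1 <= count (fun k' => (g - k') ^+ 2 == 1 + g ^+ 2)%R hs)%N.
    apply: (@size_le_count _ _ [:: - g] hs) => //.
    by rewrite /= hsE !in_cons eqxx ?orbT /= andbT; apply/eqP; lra.
  have eNg : (1 <= count (fun k' => (- g - k') ^+ 2 == 1 + (- g) ^+ 2)%R hs)%N.
    apply: (@size_le_count _ _ [:: g] hs) => //.
    by rewrite /= hsE !in_cons eqxx ?orbT /= andbT; apply/eqP; lra.
  have eh : (m <= \sum_(i <- iota 0 m.+1)
      count (fun k' => (h i.+1 - k') ^+ 2 == 1 + h i.+1 ^+ 2)%R hs)%N.
    (* The last height is dropped, as its successor is not in [hs]. *)
    rewrite -addn1 iotaD big_cat /=; apply: leq_trans (leq_addr _ _).
    rewrite -[leqLHS](size_iota 0) -sum1_size big_seq [leqRHS]big_seq.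
    apply: leq_sum => i; rewrite mem_iota => /= im.
    apply: (@size_le_count _ _ [:: h i.+2] hs) => //.
    by rewrite /= mem_h //= andbT hS.
  rewrite (_ : m.+4 = 2 + (0 + (1 + (1 + m))))%N; last by lia.
  by do !apply: leq_add.
exists hs, g; split=> //; last by rewrite bE addSn addnC ltnS.
by apply/allP; rewrite /= one_hs hsE !in_cons !eqxx !orbT.
Qed.

Lemma fav_lower (R : realType) (a b : nat) : (8 <= a)%N -> (5 <= b)%N ->
  (a * b + 4 * a + b <= (f3 R (a + b)).+1)%N.
Proof.
move=> a8 b5.
have [cs [q [cs_uniq cs_size cs_norm q_val cs_count]]] := circle_config R a8.
have [hs [g [hs_uniq hs_size [g0 g2] hs_sub axis_count]]] := axis_config R b5.
pose s := map (@circle_pt R) cs ++ map (@axis_pt R) hs.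
have circle_inj : injective (@circle_pt R).
  move=> [x y] [x' y'] /= e; congr (_, _).
    by move: (congr1 (@cx R) e); rewrite !c_pt.
  by move: (congr1 (@cy R) e); rewrite !c_pt.
have axis_inj : injective (@axis_pt R).
  by move=> x x' /(congr1 (@cz R)); rewrite !c_pt.
have s_uniq : uniq s.
  rewrite cat_uniq !map_inj_uniq // cs_uniq hs_uniq andbT /=.
  apply/hasPn => _ /mapP[y _ ->]; apply/mapP => -[p /cs_norm p1 e].
  move: p1 (congr1 (@cx R) e) (congr1 (@cy R) e); rewrite !c_pt => p1 x0 y0.
  by move: p1; rewrite -x0 -y0; lra.
have s_size : size s = (a + b)%N by rewrite size_cat !size_map cs_size hs_size.
pose r2 (x : 'rV[R]_3) : R := if (cx x == 0) && (cy x == 0) then 1 + cz x ^+ 2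
  else q (cx x, cy x).
have r2_axis k : r2 (axis_pt k) = 1 + k ^+ 2 by rewrite /r2 !c_pt !eqxx.
have r2_circle p : p \in cs -> r2 (circle_pt p) = q p.
  move=> /cs_norm p1; rewrite /r2 !c_pt -surjective_pairing.
  by case: eqP p1 => //= ->; case: eqP => //= ->; lra.
have r2_gt0 : {in s, forall x, 0 < r2 x}.
  move=> x; rewrite mem_cat => /orP[/mapP[p pcs ->]|/mapP[k _ ->]].
    by rewrite r2_circle //; case: (q_val p pcs) => ->; lra.
  by rewrite r2_axis ltr_pwDl ?sqr_ge0.
suff cnt : (a * b + 4 * a + b <= (\sum_(x <- s) count (fun y => sqdist x y == r2 x) s).+1)%N.
  by apply: leq_trans cnt _; rewrite ltnS -s_size; apply: f3_ge_seq.
have circle_count p : p \in cs ->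
    (4 <= count (fun y => sqdist (circle_pt p) y == r2 (circle_pt p)) s)%N.
  move=> pcs; have p1 := cs_norm _ pcs.
  rewrite count_cat !count_map r2_circle // (_ : 4 = 2 + 2)%N //; apply: leq_add.
    rewrite (eq_count (a2 := fun p' => (p.1 - p'.1) ^+ 2 + (p.2 - p'.2) ^+ 2 == q p)).
      exact: cs_count.
    by move=> p' /=; rewrite sqdist_circle.
  (* A circle point reaches the heights [k] with [1 + k ^ 2 = q p]. *)
  have [qp|qp] := q_val p pcs; rewrite qp.
    apply: (@size_le_count _ _ [:: 1; - 1] hs).
      by rewrite /= inE andbT; apply/eqP; lra.
    rewrite /= !hs_sub ?inE ?eqxx ?orbT //= !sqdist_circle_axis //.
    by rewrite sqrrN expr1n !eqxx.
  apply: (@size_le_count _ _ [:: g; - g] hs).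
    by rewrite /= inE andbT; apply/eqP; lra.
  rewrite /= !hs_sub ?inE ?eqxx ?orbT //= !sqdist_circle_axis //.
  by rewrite andbT; apply/andP; split; apply/eqP; rewrite ?sqrrN g2; lra.
set D := (\sum_(k <- hs) _)%N in axis_count.
have circle_sum : (4 * a <= \sum_(p <- cs)
    count (fun y => sqdist (circle_pt p) y == r2 (circle_pt p)) s)%N.
  rewrite -cs_size -iter_addn_0 -(count_predT cs) -big_const_seq.
  by rewrite big_seq [leqRHS]big_seq; apply: leq_sum => p; apply: circle_count.
have axis_sum : (a * b + D <= \sum_(k <- hs)
    count (fun y => sqdist (axis_pt k) y == r2 (axis_pt k)) s)%N.
  rewrite -hs_size -iter_addn_0 -(count_predT hs) -big_const_seq -big_split.
  apply: leq_sum => k _; rewrite r2_axis count_cat !count_map -cs_size leq_add //.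
    apply/eq_leq/esym/eqP; rewrite -all_count; apply/allP => p /cs_norm p1 /=.
    by rewrite sqdist_axis_circle.
  by apply/eq_leq/eq_count => k' /=; rewrite sqdist_axis.
rewrite big_cat !big_map.
apply: (@leq_trans (4 * a + (a * b + D)).+1); first by clear -axis_count; lia.
by rewrite ltnS; apply: leq_add.
Qed.

(** * Choice of the sizes and rounding *)

Unset Implicit Arguments.

Theorem theorem1 (R : realType) :
  exists n0 : nat, forall n : nat, (n0 <= n)%N ->
    (Num.ceil (n%:R ^+ 2 / 4 + 5 * n%:R / 2 : R) + 1 <= (f3 R n)%:Z) /\
    ((f3 R n)%:Z <= Num.ceil (n%:R ^+ 2 / 4 + 5 * n%:R / 2 : R) + 12).
Proof.
have [n0 upper] := num_fav_edges_le; exists (n0 + 20)%N => n n_ge.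
have hi : (4 * f3 R n <= n * n + 10 * n + 49)%N.
  have [[S [r [Sn r0 <-]]] _] := f3P R n.
  by have := upper R S r; rewrite Sn; apply=> //; lia.
have lo : (n * n + 10 * n + 4 <= 4 * f3 R n)%N.
  (* For [n = a + b], [4 * (a * b + 4 * a + b - 1) = n ^ 2 + 10 * n + 5 - (a - b - 3) ^ 2]; hence
     [a - b] is 3 for odd [n] and 2 for even [n]. *)
  have [k [nk|nk]] : exists k, n = (2 * k)%N \/ n = (2 * k).+1.
  - by exists (n %/ 2)%N; lia.
  - have := @fav_lower R k.+1 k.-1; rewrite (_ : (k.+1 + k.-1)%N = n); last lia.
    by case: k nk => [|k] nk; [lia | nia].
  - have := @fav_lower R k.+2 k.-1; rewrite (_ : (k.+2 + k.-1)%N = n); last lia.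
    by case: k nk => [|k] nk; [lia | nia].
split.
- rewrite -lerBrDr ceil_le_int rmorphB /=.
  by move: lo; rewrite -(ler_nat R) !natrD !natrM; lra.
(* An integer is below a ceiling exactly when it is below the number itself, so the claim reads
   [4 * f3 R n < n ^ 2 + 10 * n + 52]. *)
- rewrite -lerBlDr (_ : _ - 12 = (f3 R n)%:Z - 13 + 1); last by lia.
  rewrite lezD1 ceil_gt_int rmorphB /=.
  by move: hi; rewrite -(ler_nat R) !natrD !natrM; lra.
Qed.
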